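(* Let $f$ satisfy $(\mathcal A)$, let $t_0>0$, $\gamma>1$, and let $\tau:[t_0,+\infty[\to\,]0,+\infty[$ be twice continuously differentiable with $\dot\tau(t)>0$ for all $t$ and $\lim_{t\to+\infty}\tau(t)=+\infty$. Let $x:[t_0,+\infty[\to\mathcal H$ be a twice continuously differentiable solution of $$\ddot x(t)+\frac{(1+\gamma)\dot\tau(t)^2-\tau(t)\ddot\tau(t)}{\tau(t)\dot\tau(t)}\dot x(t)+\gamma\frac{\dot\tau(t)^2}{\tau(t)}\nabla f\Big(x(t)+\frac1\gamma\frac{\tau(t)}{\dot\tau(t)}\dot x(t)\Big)=0 .$$ Then $f(x(t))-\inf_{\mathcal H}f=o\big(1/\tau(t)\big)$ as $t\to+\infty$, and $x(t)$ converges weakly as $t\to+\infty$ to an element of $S=\operatorname{argmin} f$.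
   Context: $\mathcal H$ is a real Hilbert space. Assumption $(\mathcal A)$: $f:\mathcal H\to\mathbb R$ is convex and continuously differentiable, $S=\operatorname{argmin}_{\mathcal H} f\neq\emptyset$, and $\nabla f$ is Lipschitz continuous on bounded subsets of $\mathcal H$. *)

(* Defs.v *)
From HB Require Import structures.
From mathcomp Require Import all_boot all_order all_algebra.
From mathcomp Require Import all_classical all_reals all_analysis.
Set Implicit Arguments. Unset Strict Implicit. Unset Printing Implicit Defensive.
Import Order.TTheory GRing.Theory Num.Theory.
Import numFieldNormedType.Exports.
Local Open Scope classical_set_scope.
Local Open Scope ring_scope.

(* [ip] is an inner product on the normed space [H] inducing its norm.
   Together with completeness of [H] this makes [H] a real Hilbert space. *)
Definition is_inner_product (R : realType) (H : normedModType R)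
  (ip : H -> H -> R) : Prop :=
  [/\ forall x y, ip x y = ip y x,
      forall (a : R) x y z, ip (a *: x + y) z = a * ip x z + ip y z
    & forall x, `|x| ^+ 2 = ip x x].

Definition is_gradient (R : realType) (H : normedModType R)
  (ip : H -> H -> R) (f : H -> R^o) (g : H -> H) : Prop :=
  forall x, differentiable f x /\ forall h, 'd f x h = ip (g x) h.

Definition convex_fun (R : realType) (H : normedModType R) (f : H -> R) : Prop :=
  forall x y (l : R), 0 <= l <= 1 ->
    f (l *: x + (1 - l) *: y) <= l * f x + (1 - l) * f y.

Definition is_argmin (R : realType) (H : normedModType R) (f : H -> R) (z : H) :=
  forall y, f z <= f y.

Definition lipschitz_on_bounded (R : realType) (H : normedModType R) (g : H -> H) :=
  forall B : set H, bounded_set B ->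
    exists L : R, forall u v, B u -> B v -> `|g u - g v| <= L * `|u - v|.

Definition deriv_on_Ici (R : realType) (V : normedModType R) (t0 : R)
  (f f' : R -> V) : Prop :=
  forall t, t0 <= t ->
    (fun h : R => h^-1 *: (f (t + h) - f t)) @
      (if t == t0 then at_right (0 : R) else (0 : R)^') --> f' t.

(* Main.v *)
(* Put y = x + (tau / (gamma tau')) x'.  The second-order equation is
   equivalent to the first-order system y' = - tau' grad f(y),
   x' = gamma (tau' / tau) (y - x): y is the gradient flow of f run at time tau,
   and x is its average against the weight tau^gamma.  For a minimizer z, both
   |y - z|^2 / 2 and |y - z|^2 / 2 + tau (f(y) - f(z)) are nonincreasing, hence
   tau (f(y) - f(z)) converges; a positive limit c would make
   |y - z|^2 / 2 + (c / 2) ln tau nonincreasing, which is impossible.  Weak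
   convergence of y follows from Opial's lemma.  Both properties pass to x,
   because v' <= (tau' / tau) (b - a v) with a > 0 and b -> 0 forces
   limsup v <= 0; gamma > 1 is what makes a = gamma - 1 positive for
   v = tau (f(x) - f(z)). *)
Require Import Defs.
From HB Require Import structures.
From mathcomp Require Import all_boot all_order all_algebra.
From mathcomp Require Import all_classical all_reals all_analysis.
From mathcomp Require Import ring lra.
Set Implicit Arguments. Unset Strict Implicit. Unset Printing Implicit Defensive.
Import Order.TTheory GRing.Theory Num.Theory.
Import numFieldNormedType.Exports.
Local Open Scope classical_set_scope.
Local Open Scope ring_scope.

(** * Derivatives along the half-line *)

(** Translates between the library's derivative in direction [1] and the plain quotient in [t + h]
    of [deriv_on_Ici]. *)
Lemma is_derive1P (R : realType) (V : normedModType R) (f : R -> V) (t : R)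
    (d : V) :
  is_derive t 1 f d <->
  (fun h : R => h^-1 *: (f (t + h) - f t)) @ 0^' --> d.
Proof.
have E : (fun h : R => h^-1 *: ((f \o shift t) (h *: 1) - f t)) =
         (fun h : R => h^-1 *: (f (t + h) - f t)).
  by apply/funext => h /=; rewrite [h *: 1]mulr1 [h + t]addrC.
split=> [[fd <-]|fd]; first by rewrite -E; exact: fd.
by split; rewrite /derivable /derive E; [apply/cvg_ex; exists d|exact: cvg_lim].
Qed.

(** At [t0] only a one-sided quotient is available, so later facts are asked for [t0 < t]; limits at
    [+oo] do not see the difference. *)
Lemma deriv_on_Ici_is_derive (R : realType) (V : normedModType R) (t0 : R)
    (f f' : R -> V) : deriv_on_Ici t0 f f' ->
  forall t, t0 < t -> is_derive t 1 f (f' t).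
Proof.
move=> df t t0t; apply/is_derive1P.
by have := df t (ltW t0t); rewrite gt_eqF.
Qed.

Lemma is_derive1_cvg0 (R : realType) (V : normedModType R) (f : R -> V)
    (t : R) (d : V) :
  is_derive t 1 f d -> f (t + h) @[h --> 0^'] --> f t.
Proof.
move=> [/derivable1_diffP /differentiable_continuous fc _].
have : {for 0, continuous (fun h : R => f (t + h))}.
  apply: continuous_comp; last by rewrite addr0.
  by apply: cvgD; [exact: cvg_cst|exact: cvg_id].
by move=> /continuous_withinNx; rewrite addr0.
Qed.

(** The increment is split with the scalar taken at [t + h], whence the continuity of [a]. It serves
    to differentiate the [dx] term of [y]. *)
Lemma is_derive1_scale (R : realType) (V : normedModType R) (a : R -> R)
    (v : R -> V) (t da : R) (dv : V) :
  is_derive t 1 a da -> is_derive t 1 v dv ->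
  is_derive t 1 (fun s => a s *: v s) (a t *: dv + da *: v t).
Proof.
move=> ha hv; have ac := is_derive1_cvg0 ha.
move/is_derive1P: ha => ha; move/is_derive1P: hv => hv; apply/is_derive1P.
rewrite (_ : (fun h => _) = (fun h : R => a (t + h) *: (h^-1 *: (v (t + h) - v t))
   + (h^-1 *: (a (t + h) - a t)) *: v t)).
  by apply: cvgD; [exact: cvgZ|exact: cvgZr_tmp].
apply/funext => h.
have -> : a (t + h) *: v (t + h) - a t *: v t =
    a (t + h) *: (v (t + h) - v t) + (a (t + h) - a t) *: v t.
  by rewrite scalerBr scalerBl addrA subrK.
by rewrite scalerDr !scalerA [h^-1 * a _]mulrC.
Qed.

(** * Monotonicity and differential inequalities near infinity *)

Lemma nonincreasing_of_is_derive (R : realType) (F dF : R -> R) (a : R) :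
  (forall t, a <= t -> is_derive t 1 F (dF t)) ->
  (forall t, a <= t -> dF t <= 0) ->
  forall s t, a <= s -> s <= t -> F t <= F s.
Proof.
move=> hF dF0; apply: ler0_derive1_nincry => [x|x|].
- by rewrite in_itv/= andbT => /ltW ax; case: (hF _ ax).
- rewrite in_itv/= andbT => /ltW ax; rewrite derive1E.
  by case: (hF _ ax) => _ ->; exact: dF0.
- apply: derivable_within_continuous => x; rewrite in_itv/= andbT => ax.
  by case: (hF _ ax).
Qed.

Lemma nonincreasing_cvg_pinfty (R : realType) (F : R -> R) (a m : R) :
  (forall s t, a <= s -> s <= t -> F t <= F s) ->
  (forall t, a <= t -> m <= F t) -> exists l : R, F @ +oo --> l.
Proof.
(* Freezing [F] to the left of [a] and changing sign gives a function monotone and bounded on the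
   whole line, equal to [- F] near [+oo]. *)
move=> Fni mF; pose G t := - F (Num.max a t).
have Gnd : nondecreasing_fun G.
  move=> s t st; rewrite /G lerN2; apply: Fni; first by rewrite le_max lexx.
  by rewrite ge_max !le_max lexx st orbT.
have Gub : has_ubound (range G).
  by exists (- m) => _ [t _ <-]; rewrite /G lerN2; apply: mF; rewrite le_max lexx.
have /cvgN GN := nondecreasing_cvgr Gnd Gub.
exists (- sup (range G)); apply: cvg_trans GN; apply: near_eq_cvg.
near=> t; rewrite /G/= opprK max_r//.
Unshelve. all: by end_near. Qed.

(* [(v - e) tau^a] is nonincreasing once [b <= a e]; hence
   [v <= e + O(tau^-a)]. *)
Lemma limsup_le0_of_relaxation (R : realType) (tau dtau v dv b : R -> R)
    (t0 a : R) :
  0 < a ->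
  (forall t, t0 < t -> 0 < tau t) -> (forall t, t0 < t -> 0 < dtau t) ->
  (forall t, t0 < t -> is_derive t 1 tau (dtau t)) ->
  tau @ +oo --> +oo ->
  (forall t, t0 < t -> is_derive t 1 v (dv t)) ->
  (forall t, t0 < t -> dv t <= dtau t / tau t * (b t - a * v t)) ->
  b @ +oo --> (0 : R) ->
  forall e, 0 < e -> \forall t \near +oo, v t <= e.
Proof.
move=> a0 tau0 dtau0 Dtau tauy Dv dvle b0 e e0.
(* One half of [e] absorbs [b], the other the decaying term [C / tau^a]. *)
pose d := e / 2; have d0 : 0 < d by rewrite divr_gt0.
have [T [t0T bT]] : exists T, t0 < T /\ forall t, T <= t -> b t <= a * d.
  have /cvgr_le/(_ (a * d)) := b0.
  rewrite mulr_gt0// => /(_ isT)[M [_ bM]].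
  exists (Num.max t0 M + 1); split; first by rewrite ltr_pwDr// le_max lexx.
  move=> t Tt; apply: bM; apply: lt_le_trans Tt.
  by rewrite ltr_pwDr// le_max lexx orbT.
(* [P] is [tau^a], the integrating factor of [v' = - a (tau' / tau) v]. *)
pose P t := expR (a * ln (tau t)).
have DP t : t0 < t -> is_derive t 1 P (P t * (a * (dtau t / tau t))).
  move=> t0t; have t_gt0 := tau0 _ t0t; have Dt := Dtau _ t0t.
  have Dln := is_derive1_comp (is_derive1_ln t_gt0) Dt.
  have Dal : is_derive t 1 (fun s => a * ln (tau s)) (a * ((tau t)^-1 * dtau t)).
    exact (is_deriveZ a Dln).
  refine (is_derive_eq (is_derive1_comp (is_derive_expR _) Dal) _).
  by rewrite /P [(tau t)^-1 * _]mulrC.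
have ni s t : T <= s -> s <= t -> (v t - d) * P t <= (v s - d) * P s.
  move: s t.
  apply: (@nonincreasing_of_is_derive R (fun t => (v t - d) * P t)
    (fun t => (v t - d) * (P t * (a * (dtau t / tau t))) + P t * dv t)) => t Tt.
    have t0t := lt_le_trans t0T Tt.
    have Dvt := Dv _ t0t; have DPt := DP _ t0t.
    have Dvd : is_derive t 1 (fun s => v s - d) (dv t).
      refine (is_derive_eq (is_deriveB Dvt (is_derive_cst d t 1)) _).
      by rewrite subr0.
    exact (is_deriveM Dvd DPt).
  have t0t := lt_le_trans t0T Tt.
  have P0 : 0 < P t by exact: expR_gt0.
  have r0 : 0 < dtau t / tau t by rewrite divr_gt0 ?tau0 ?dtau0.
  rewrite mulrCA -mulrDr pmulr_rle0//.
  have := dvle _ t0t; have := bT _ Tt.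
  set r := dtau t / tau t in r0 *; nra.
have [C C0 hC] : exists2 C, 0 < C & (v T - d) * P T <= C.
  exists (Num.max 1 ((v T - d) * P T)); last by rewrite le_max lexx orbT.
  by rewrite lt_max ltr01.
(* Beyond this threshold, [(C / d)^(1/a)], the factor [P] is at least [C / d]; [C] was taken
   positive so that the logarithm makes sense. *)
have /cvgry_ge/(_ (expR (a^-1 * ln (C / d)))) := tauy.
apply: filterS2 (nbhs_pinfty_gt (num_real T)) => t /ltW Tt tauC.
have t0t := lt_le_trans t0T Tt.
have Cd0 : 0 < C / d by rewrite divr_gt0.
have CP : C / d <= P t.
  rewrite -[C / d](@lnK R) ?posrE// /P ler_expR -ler_pdivrMl//.
  by rewrite -[leLHS](@expRK R) ler_ln ?posrE ?expR_gt0 ?tau0.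
have := ni T t (lexx _) Tt.
have P0 : 0 < P t by exact: expR_gt0.
move: CP; rewrite ler_pdivrMr// => CP h.
have : (v t - d) * P t <= d * P t by rewrite mulrC in CP; lra.
rewrite ler_pM2r// /d; lra.
Qed.

(** * Inner products *)

Section InnerProduct.
Context {R : realType} {H : normedModType R} {ip : H -> H -> R}.
Context (hip : is_inner_product ip).

Lemma ipC u v : ip u v = ip v u.
Proof. by case: hip. Qed.

Lemma ip_norm u : ip u u = `|u| ^+ 2.
Proof. by case: hip => _ _ ->. Qed.

Lemma ipDl u v w : ip (u + v) w = ip u w + ip v w.
Proof. by case: hip => _ lin _; rewrite -[u in LHS]scale1r lin mul1r. Qed.

Lemma ip0l w : ip 0 w = 0.
Proof. by apply: (addIr (ip 0 w)); rewrite -ipDl !add0r. Qed.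

Lemma ipZl a u w : ip (a *: u) w = a * ip u w.
Proof. by case: hip => _ lin _; rewrite -[_ *: _]addr0 lin ip0l addr0. Qed.

Lemma ipNl u w : ip (- u) w = - ip u w.
Proof. by rewrite -scaleN1r ipZl mulN1r. Qed.

Lemma ipBl u v w : ip (u - v) w = ip u w - ip v w.
Proof. by rewrite ipDl ipNl. Qed.

Lemma ipDr u v w : ip w (u + v) = ip w u + ip w v.
Proof. by rewrite ipC ipDl !(ipC w). Qed.

Lemma ipZr a u w : ip w (a *: u) = a * ip w u.
Proof. by rewrite ipC ipZl (ipC w). Qed.

Lemma ipNr u w : ip w (- u) = - ip w u.
Proof. by rewrite ipC ipNl (ipC w). Qed.

Lemma ipBr u v w : ip w (u - v) = ip w u - ip w v.
Proof. by rewrite ipDr ipNr. Qed.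

Lemma normD_sqr u v : `|u + v| ^+ 2 = `|u| ^+ 2 + 2 * ip u v + `|v| ^+ 2.
Proof. by rewrite -!ip_norm !(ipDl, ipDr) (ipC v u); ring. Qed.

Lemma normB_sqr u v : `|u - v| ^+ 2 = `|u| ^+ 2 - 2 * ip u v + `|v| ^+ 2.
Proof. by rewrite normD_sqr ipNr normrN; ring. Qed.

Lemma ip_polarization u v : ip u v = (`|u + v| ^+ 2 - `|u - v| ^+ 2) / 4.
Proof. by rewrite normD_sqr normB_sqr; field. Qed.

(** Expanding [|u + v|^2] and [|u - v|^2] suffices; this weak form of Cauchy-Schwarz does wherever
    only some finite bound matters. *)
Lemma ip_le_sqr u v : `|ip u v| <= (`|u| ^+ 2 + `|v| ^+ 2) / 2.
Proof.
rewrite ler_norml; apply/andP; split.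
  by have := sqr_ge0 `|u + v|; rewrite normD_sqr; lra.
by have := sqr_ge0 `|u - v|; rewrite normB_sqr; lra.
Qed.

(** Polarization reduces joint continuity to continuity of the norm. *)
Lemma cvg_ip (T : Type) (F : set_system T) (FF : Filter F) (u v : T -> H) a b :
  u @ F --> a -> v @ F --> b -> ip (u t) (v t) @[t --> F] --> ip a b.
Proof.
move=> ua vb; rewrite ip_polarization !expr2.
under eq_fun do rewrite ip_polarization !expr2.
apply: cvgM; last exact: cvg_cst.
have cD : `|u t + v t| @[t --> F] --> `|a + b| by exact: cvg_norm (cvgD ua vb).
have cB : `|u t - v t| @[t --> F] --> `|a - b| by exact: cvg_norm (cvgB ua vb).
exact (cvgB (cvgM cD cD) (cvgM cB cB)).
Qed.

Lemma is_derive1_ip (u v : R -> H) (t : R) (du dv : H) :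
  is_derive t 1 u du -> is_derive t 1 v dv ->
  is_derive t 1 (fun s => ip (u s) (v s)) (ip du (v t) + ip (u t) dv).
Proof.
move=> hu hv; have uc := is_derive1_cvg0 hu.
move/is_derive1P: hu => hu; move/is_derive1P: hv => hv; apply/is_derive1P.
rewrite (_ : (fun h => _) = (fun h : R =>
    ip (h^-1 *: (u (t + h) - u t)) (v t) +
    ip (u (t + h)) (h^-1 *: (v (t + h) - v t)))).
  by apply: cvgD; apply: cvg_ip => //; exact: cvg_cst.
apply/funext => h; 
by rewrite ipZl ipZr ipBl ipBr -mulrDr [in RHS]addrC addrA subrK.
Qed.

Lemma is_derive1_ipl (u : R -> H) (t : R) (du w : H) :
  is_derive t 1 u du -> is_derive t 1 (fun s => ip (u s) w) (ip du w).
Proof.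
move=> hu; apply: is_derive_eq.
  exact: (is_derive1_ip hu (is_derive_cst w t 1)).
by rewrite [ip (u t) 0]ipC ip0l addr0.
Qed.

End InnerProduct.

(* The parallelogram identity makes minimizing sequences of
   [|v|^2 - 2 l(v)] Cauchy. *)
Lemma riesz_representation (R : realType) (H : completeNormedModType R)
    (ip : H -> H -> R) (l : H -> R) (M : R) :
  is_inner_product ip ->
  (forall a u v, l (a *: u + v) = a * l u + l v) ->
  (forall u, l u <= (M ^+ 2 + `|u| ^+ 2) / 2) ->
  exists z, forall u, l u = ip z u.
Proof.
move=> hip lin lM.
pose J v := `|v| ^+ 2 - 2 * l v.
have Jge v : - M ^+ 2 <= J v by rewrite /J; have := lM v; lra.
have Jinf : has_inf (range J).
  by split; [exists (J 0), 0|exists (- M ^+ 2) => _ [v _ <-]].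
set m := inf (range J).
have mJ v : m <= J v by apply: ge_inf; [case: Jinf|exists v].
have /choice[w wP] : forall n : nat, exists v, J v < m + n.+1%:R^-1.
  move=> n; have n0 : 0 < n.+1%:R^-1 :> R by rewrite invr_gt0.
  by have [_ [v _ <-] Jv] := inf_adherent n0 Jinf; exists v.
move: m mJ wP => m mJ wP.
have l0 : l 0 = 0.
  have := lin 1 0 0; rewrite scale1r addr0 mul1r => /eqP.
  by rewrite addrC -subr_eq subrr eq_sym => /eqP.
have lZ a u : l (a *: u) = a * l u by have := lin a u 0; rewrite addr0 l0 addr0.
have lD u v : l (u + v) = l u + l v by have := lin 1 u v; rewrite scale1r mul1r.
have par u v : `|u - v| ^+ 2 = 2 * J u + 2 * J v - 4 * J (2^-1 *: (u + v)).
  rewrite /J lZ lD normrZ exprMn (normB_sqr hip) (normD_sqr hip).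
  by rewrite ger0_norm//; field.
have wc : cvg (w @ \oo).
  apply/cauchy_cvgP/cauchy_ballP => e e0.
  (* The midpoint value in [par] is at least [m], so two excesses below [e^2 / 4], each counted
     twice, give [|w n - w k|^2 < e^2]. *)
  have d0 : 0 < e ^+ 2 / 4 by rewrite divr_gt0 ?exprn_gt0.
  have small : \forall n \near \oo, (n.+1%:R^-1 : R) < e ^+ 2 / 4.
    exact: near_infty_natSinv_lt (PosNum d0).
  near_simpl; near=> n k.
  have : `|w n - w k| ^+ 2 < e ^+ 2.
    rewrite par; have := mJ (2^-1 *: (w n + w k)); have := wP n; have := wP k.
    have hn : (n.+1%:R^-1 : R) < e ^+ 2 / 4 by near: n.
    have hk : (k.+1%:R^-1 : R) < e ^+ 2 / 4 by near: k.
    move: (J (w n)) (J (w k)) (J _) n.+1%:R^-1 k.+1%:R^-1 hn hk => *; lra.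
  by rewrite ltr_sqr ?nnegrE ?(ltW e0)// -ball_normE.
exists (lim (w @ \oo)) => h; set z := lim _.
(* First-order optimality: this is [J (z + s h) - J z >= 0], obtained as a limit from
   [m <= J (w n + s h)] and [J (w n) < m + 1/(n+1)]. *)
have key s : 0 <= 2 * s * (ip z h - l h) + s ^+ 2 * `|h| ^+ 2.
  have cvgz : 2 * s * (ip (w n) h - l h) + s ^+ 2 * `|h| ^+ 2 + n.+1%:R^-1
      @[n --> \oo] --> 2 * s * (ip z h - l h) + s ^+ 2 * `|h| ^+ 2 + 0.
    apply: cvgD; last exact: cvg_harmonic.
    apply: cvgD; last exact: cvg_cst.
    apply: cvgM; first exact: cvg_cst.
    by apply: cvgB; [apply: (cvg_ip hip) => //|]; exact: cvg_cst.
  rewrite -[leRHS]addr0; apply: (cvgr_to_ge cvgz); near=> n.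
  have := mJ (w n + s *: h); have := wP n.
  rewrite /J lD lZ (normD_sqr hip) (ipZr hip) normrZ exprMn real_normK ?num_real//.
  by move: n.+1%:R^-1 => i; lra.
(* Nearly the minimizing [s]; the [+ 1] avoids a zero denominator when [h = 0]. *)
have := key (- (ip z h - l h) / (`|h| ^+ 2 + 1)).
set c := ip z h - l h; set p := `|h| ^+ 2 => hc.
have p0 : 0 <= p by exact: sqr_ge0.
suff : c ^+ 2 <= 0 by rewrite exprn_even_le0//= subr_eq0 eq_sym => /eqP.
have E : 2 * (- c / (p + 1)) * c + (- c / (p + 1)) ^+ 2 * p
    = - (c ^+ 2 * ((p + 2) / (p + 1) ^+ 2)).
  by field; rewrite gt_eqF// ltr_wpDl.
move: hc; rewrite E oppr_ge0 pmulr_lle0// divr_gt0 ?exprn_gt0//; lra.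
Unshelve. all: by end_near. Qed.

(** * Weak convergence *)

(** Compactness of [[-M, M]] yields a cluster point, and an ultrafilter converges to each of its
    cluster points. Ultrafilters replace the extraction of subsequences. *)
Lemma ultra_bounded_cvg (R : realType) (T : Type) (U : set_system T)
    (phi : T -> R) (M : R) :
  UltraFilter U -> (\forall t \near U, `|phi t| <= M) ->
  exists l : R, phi @ U --> l.
Proof.
move=> UU bM; have UP := ultra_proper.
have UM : (phi @ U) `[- M, M]%classic.
  by apply: filterS bM => t /=; rewrite in_itv/= ler_norml.
have [l [_ cl]] := @segment_compact R (- M) M (phi @ U) _ UM.
exists l => B nB.
have [UB|UC] := in_ultra_setVsetC (phi @^-1` B) UU; first exact: UB.
have CB : (phi @ U) (~` B) by exact: UC.
by have [x [nBx /nBx]] := cl _ _ CB nB.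
Qed.

(** Weak compactness of balls: the limits of [ip (y t) h] depend linearly on [h] and are bounded, so
    the Riesz lemma represents them. *)
Lemma ultra_weak_cvg (R : realType) (H : completeNormedModType R)
    (ip : H -> H -> R) (T : Type) (U : set_system T) (y : T -> H) (M : R) :
  is_inner_product ip -> UltraFilter U -> (\forall t \near U, `|y t| <= M) ->
  exists z, forall h, ip (y t) h @[t --> U] --> ip z h.
Proof.
move=> hip UU bM; have UP := ultra_proper.
have bip h : \forall t \near U, `|ip (y t) h| <= (M ^+ 2 + `|h| ^+ 2) / 2.
  apply: filterS bM => t yM; apply: le_trans (ip_le_sqr hip _ _) _.
  by rewrite ler_pM2r// lerD2r lerXn2r ?nnegrE// (le_trans _ yM).
have /choice[l lP] h : exists l : R, ip (y t) h @[t --> U] --> l.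
  exact: ultra_bounded_cvg (bip h).
have lin a u v : l (a *: u + v) = a * l u + l v.
  apply: (@norm_cvg_unique _ _ (ip (y t) (a *: u + v) @[t --> U])) => //=.
  rewrite (_ : (fun t => _) = (fun t => a * ip (y t) u + ip (y t) v)).
    by apply: cvgD => //; apply: cvgM => //; exact: cvg_cst.
  by apply/funext => t; rewrite (ipDr hip) (ipZr hip).
have lM u : l u <= (M ^+ 2 + `|u| ^+ 2) / 2.
  apply: (cvgr_to_le (lP u)); apply: filterS (bip u) => t.
  exact: le_trans (ler_norm _).
have [z zP] := riesz_representation hip lin lM.
by exists z => h; rewrite -zP.
Qed.

(* Opial's lemma.  Two limits [z], [z'] along ultrafilters agree because
   [|y - z|^2 - |y - z'|^2] converges, hence so does [<y, z - z'>]. *)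
Lemma opial (R : realType) (H : completeNormedModType R) (ip : H -> H -> R)
    (T : Type) (F : set_system T) (S : set H) (y : T -> H) (M : R) :
  is_inner_product ip -> ProperFilter F ->
  (\forall t \near F, `|y t| <= M) ->
  (forall z, S z -> exists l : R, `|y t - z| ^+ 2 @[t --> F] --> l) ->
  (forall U z, UltraFilter U -> F `<=` U ->
     (forall h, ip (y t) h @[t --> U] --> ip z h) -> S z) ->
  exists2 z, S z & forall h, ip (y t) h @[t --> F] --> ip z h.
Proof.
move=> hip FF bM cS clS.
have [U [UU FU]] := ultraFilterLemma FF.
have UP := @ultra_proper _ _ UU.
have [z zP] := ultra_weak_cvg hip UU (FU _ bM).
have Sz := clS _ _ UU FU zP.
exists z => // h; apply: contrapT => ncvg.
have [e e0 ne] : exists2 e : R, 0 < e &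
    ~ \forall t \near F, `|ip z h - ip (y t) h| < e.
  apply: contrapT => ce; apply: ncvg; apply/cvgrPdist_lt => e e0.
  by apply: contrapT => ne; apply: ce; exists e.
(* Non-convergence says that [A] meets every set of [F]. An ultrafilter [V] containing [F] and [A]
   has a weak limit [z'], and [z' = z] is absurd on [A]. *)
pose A := [set t | ~ (`|ip z h - ip (y t) h| < e)].
have AF : ProperFilter (within A F).
  apply: Build_ProperFilter => A0; apply: ne; move: A0.
  rewrite /within/=; apply: filterS => t tA.
  by apply: contrapT => /tA.
have [V [VU AV]] := ultraFilterLemma AF.
have VP := @ultra_proper _ _ VU.
have FV : F `<=` V by move=> B FB; apply: AV; apply: filterS FB => t Bt _.
have [z' zP'] := ultra_weak_cvg hip VU (FV _ bM).
have Sz' := clS _ _ VU FV zP'.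
have [l lP] := cS _ Sz; have [l' lP'] := cS _ Sz'.
(* In [|y - z|^2 - |y - z'|^2] the term [|y|^2] cancels, leaving an affine function of
   [ip y (z - z')]. *)
have cvgd : exists c : R, ip (y t) (z - z') @[t --> F] --> c.
  exists (((`|z| ^+ 2 - `|z'| ^+ 2) - (l - l')) / 2).
  rewrite (_ : (fun t => _) = (fun t => ((`|z| ^+ 2 - `|z'| ^+ 2) -
      (`|y t - z| ^+ 2 - `|y t - z'| ^+ 2)) / 2)).
    apply: cvgM; last exact: cvg_cst.
    by apply: cvgB; [exact: cvg_cst|exact: cvgB].
  by apply/funext => t; rewrite !(normB_sqr hip) (ipBr hip); field.
have [c cP] := cvgd.
have czU : ip z (z - z') = c.
  apply: (@norm_cvg_unique _ _ (ip (y t) (z - z') @[t --> U])) => /=; first exact: zP.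
  by move=> B nB; exact: FU (cP B nB).
have czV : ip z' (z - z') = c.
  apply: (@norm_cvg_unique _ _ (ip (y t) (z - z') @[t --> V])) => /=; first exact: zP'.
  by move=> B nB; exact: FV (cP B nB).
have zz' : z = z'.
  apply/eqP; rewrite -subr_eq0 -normr_eq0 -sqrf_eq0 -(ip_norm hip).
  by rewrite (ipBl hip) czU czV subrr.
have VA : V A by apply: AV; exact: withinT.
have Ve : \forall t \near V, `|ip z h - ip (y t) h| < e.
  by move: (zP' h); rewrite -zz' => /cvgrPdist_lt; apply.
by have [t [At]] := filter_ex (filterI VA Ve).
Qed.

(** * Convex differentiable functions *)

(** For [0 < h <= 1] convexity bounds the quotient from [u] towards [v] by [f v - f u]; its limit as
    [h] decreases to 0 is the directional derivative. *)
Lemma convex_gradient_le (R : realType) (H : normedModType R)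
    (ip : H -> H -> R) (f : H -> R) (g : H -> H) :
  convex_fun f -> is_gradient ip f g ->
  forall u v, f u + ip (g u) (v - u) <= f v.
Proof.
move=> cvx gr u v; have [df dfE] := gr u.
rewrite -dfE -deriveE// addrC -lerBrDr.
have D : h^-1 *: (f (h *: (v - u) + u) - f u) @[h --> (0 : R)^'+] -->
    'D_(v - u) f u.
  by apply: cvg_dnbhs_at_right; exact: (@diff_derivable _ _ _ f u (v - u) df).
apply: (cvgr_to_le D); near=> h.
have h0 : 0 < h by [].
have h1 : h <= 1 by near: h; exact: nbhs_right_le.
rewrite [_ *: _]/(_ * _) ler_pdivrMl//.
have := cvx v u h; rewrite (ltW h0) h1 => /(_ isT).
have -> : h *: v + (1 - h) *: u = h *: (v - u) + u.
  by rewrite scalerBr scalerBl scale1r addrA addrAC.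
lra.
Unshelve. all: by end_near. Qed.

Lemma is_derive1_gradient (R : realType) (H : normedModType R)
    (ip : H -> H -> R) (f : H -> R) (g : H -> H) (u : R -> H) (t : R) (du : H) :
  is_gradient ip f g -> is_derive t 1 u du ->
  is_derive t 1 (fun s => f (u s)) (ip (g (u t)) du).
Proof.
move=> gr [/derivable1_diffP du1 duE]; have [df dfE] := gr (u t).
have dc : differentiable (f \o u) t by exact: differentiable_comp.
split; first exact/derivable1_diffP.
by rewrite deriveE// diff_comp//= -[in X in 'd f _ X]deriveE// duE dfE.
Qed.

(** * The rescaled gradient flow *)

Lemma cvg_ln_pinfty_comp (R : realType) (tau : R -> R) :
  tau @ +oo --> +oo -> forall A, \forall t \near +oo, A <= ln (tau t).
Proof.
move=> tauy A; have /cvgry_ge/(_ (expR A)) := tauy.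
apply: filterS => t At; rewrite -[A](@expRK R) ler_ln ?posrE ?expR_gt0//.
exact: lt_le_trans (expR_gt0 _) At.
Qed.

Section GradientFlow.
Context {R : realType} {H : completeNormedModType R} {ip : H -> H -> R}.
Context {f : H -> R} {g : H -> H} {t0 : R} {tau dtau : R -> R} {y : R -> H}.
Context (hip : is_inner_product ip) (cvx : convex_fun f)
  (gr : is_gradient ip f g)
  (tau0 : forall t, t0 < t -> 0 < tau t)
  (dtau0 : forall t, t0 < t -> 0 < dtau t)
  (Dtau : forall t, t0 < t -> is_derive t 1 tau (dtau t))
  (tauy : tau @ +oo --> +oo)
  (Dy : forall t, t0 < t -> is_derive t 1 y (- (dtau t *: g (y t)))).

(** A start strictly beyond [t0], since the monotonicity lemmas use closed half-lines. *)
Let T := t0 + 1.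

Let T_lt t : T <= t -> t0 < t.
Proof. by apply: lt_le_trans; rewrite ltrDl. Qed.

Lemma flow_derive_dist z t : t0 < t ->
  is_derive t 1 (fun s => `|y s - z| ^+ 2 / 2) (- dtau t * ip (g (y t)) (y t - z)).
Proof.
move=> t0t; have Dyt := Dy t0t.
have Dz : is_derive t 1 (fun s => y s - z) (- (dtau t *: g (y t))).
  refine (is_derive_eq (is_deriveB Dyt (is_derive_cst z t 1)) _).
  by rewrite subr0.
have D := is_deriveM (is_derive1_ip hip Dz Dz) (is_derive_cst (2^-1 : R) t 1).
rewrite (_ : (fun s => _) = (fun s => ip (y s - z) (y s - z) / 2)); last first.
  by apply/funext => s; rewrite (ip_norm hip).
refine (is_derive_eq D _).
have scaleE (a b : R) : a *: b = a * b by [].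
rewrite scaler0 add0r scaleE (ipC hip (y t - z)) !(ipNl hip) !(ipZl hip).
by rewrite /cst; field.
Qed.

Lemma flow_derive_value t : t0 < t ->
  is_derive t 1 (fun s => f (y s)) (- dtau t * `|g (y t)| ^+ 2).
Proof.
move=> t0t; refine (is_derive_eq (is_derive1_gradient gr (Dy t0t)) _).
by rewrite (ipNr hip) (ipZr hip) (ip_norm hip) mulNr.
Qed.

(** The gradient inequality at [y t], tested at the minimizer [z], makes the derivative of the
    distance term nonpositive. *)
Lemma flow_dist_cvg z : is_argmin f z ->
  exists l : R, `|y t - z| ^+ 2 / 2 @[t --> +oo] --> l.
Proof.
move=> zmin; apply: (@nonincreasing_cvg_pinfty _ _ T 0); last first.
  by move=> t _; rewrite divr_ge0 ?sqr_ge0.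
apply: nonincreasing_of_is_derive => t /T_lt t0t; first exact: flow_derive_dist.
have := convex_gradient_le cvx gr (y t) z; have := zmin (y t).
rewrite -opprB (ipNr hip) mulNr oppr_le0 => ? ?.
by rewrite mulr_ge0 ?(ltW (dtau0 t0t))//; lra.
Qed.

Lemma flow_value_o z : is_argmin f z ->
  tau t * (f (y t) - f z) @[t --> +oo] --> (0 : R).
Proof.
move=> zmin; have [l lP] := flow_dist_cvg zmin.
have phi0 t : 0 <= f (y t) - f z by rewrite subr_ge0.
have sub t : f (y t) - f z <= ip (g (y t)) (y t - z).
  have := convex_gradient_le cvx gr (y t) z.
  by rewrite -opprB (ipNr hip); lra.
(* Differentiating [tau] adds [dtau (f y - f z)], which [sub] absorbs into the decay of the
   distance; the remaining term is [- tau dtau |g y|^2]. *)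
have [L LP] : exists L : R,
    `|y t - z| ^+ 2 / 2 + tau t * (f (y t) - f z) @[t --> +oo] --> L.
  apply: (@nonincreasing_cvg_pinfty _ _ T 0); last first.
    move=> t /T_lt t0t; rewrite addr_ge0 ?divr_ge0 ?sqr_ge0//.
    by rewrite mulr_ge0 ?phi0 ?ltW ?tau0.
  apply: (@nonincreasing_of_is_derive _ _ (fun t =>
      - dtau t * ip (g (y t)) (y t - z) +
      (tau t * (- dtau t * `|g (y t)| ^+ 2) + (f (y t) - f z) * dtau t)))
      => t /T_lt t0t.
    have Df : is_derive t 1 (fun s => f (y s) - f z) (- dtau t * `|g (y t)| ^+ 2).
      refine (is_derive_eq
        (is_deriveB (flow_derive_value t0t)
           (is_derive_cst (f z) t 1)) _).
      by rewrite subr0.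
    exact (is_deriveD (flow_derive_dist z t0t) (is_deriveM (Dtau t0t) Df)).
  have t1 := tau0 t0t; have t2 := dtau0 t0t; have t3 := sub t.
  have : 0 <= tau t * (dtau t * `|g (y t)| ^+ 2).
    by rewrite !mulr_ge0 ?sqr_ge0// ltW.
  have : dtau t * (f (y t) - f z) <= dtau t * ip (g (y t)) (y t - z).
    by rewrite ler_pM2l.
  lra.
have cP : tau t * (f (y t) - f z) @[t --> +oo] --> L - l.
  rewrite (_ : (fun t => _) = (fun t => `|y t - z| ^+ 2 / 2 +
      tau t * (f (y t) - f z) - `|y t - z| ^+ 2 / 2)).
    exact: cvgB.
  by apply/funext => t; rewrite addrAC subrr add0r.
suff <- : L - l = 0 by [].
apply/eqP; rewrite eq_le; apply/andP; split; last first.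
  apply: (cvgr_to_ge cP); near=> t.
  have t0t : t0 < t by near: t; apply: nbhs_pinfty_gt; exact: num_real.
  exact: mulr_ge0 (ltW (tau0 t0t)) (phi0 t).
(* If [c > 0], then eventually [f y - f z >= c / (2 tau)], so the halved squared distance falls at
   least as fast as [(c / 2) ln tau] grows. *)
rewrite leNgt; apply/negP; set c := L - l in cP * => c0.
have [a [Ta aP]] : exists a, T <= a /\
    forall t, a <= t -> c / 2 <= tau t * (f (y t) - f z).
  have /cvgr_ge/(_ (c / 2)) := cP.
  rewrite ltr_pdivrMr// ltr_pMr// ltr1n => /(_ isT)[N [_ NP]].
  exists (Num.max T (N + 1)); split; first by rewrite le_max lexx.
  move=> t; rewrite ge_max => /andP[_ Nt]; apply: NP.
  by apply: lt_le_trans Nt; rewrite ltrDl.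
have ni s t : a <= s -> s <= t ->
    `|y t - z| ^+ 2 / 2 + c / 2 * ln (tau t) <=
    `|y s - z| ^+ 2 / 2 + c / 2 * ln (tau s).
  move: s t; apply: (@nonincreasing_of_is_derive _
     (fun t => `|y t - z| ^+ 2 / 2 + c / 2 * ln (tau t)) (fun t =>
      - dtau t * ip (g (y t)) (y t - z) + c / 2 * ((tau t)^-1 * dtau t)))
      => t at_; have t0t := T_lt (le_trans Ta at_).
    have Dln := is_derive1_comp (is_derive1_ln (tau0 t0t)) (Dtau t0t).
    exact (is_deriveD (flow_derive_dist z t0t) (is_deriveZ (c / 2) Dln)).
  have t1 := tau0 t0t; have t2 := dtau0 t0t; have t3 := sub t.
  have : c / 2 / tau t <= f (y t) - f z by rewrite ler_pdivrMr// [_ * tau t]mulrC aP.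
  rewrite mulrA; set q := c / 2 / tau t => qf.
  have : dtau t * q <= dtau t * ip (g (y t)) (y t - z).
    by rewrite ler_pM2l//; lra.
  lra.
set C := `|y a - z| ^+ 2 / 2 + c / 2 * ln (tau a).
(* At this level the logarithmic term alone exceeds the initial energy [C]. *)
have := cvg_ln_pinfty_comp tauy ((C + 1) / (c / 2)).
move=> /(filterI (nbhs_pinfty_gt (num_real a)))/filter_ex[t [/ltW at_]].
rewrite ler_pdivrMr ?divr_gt0// mulrC => hC.
have := ni a t (lexx _) at_; rewrite -/C.
have : 0 <= `|y t - z| ^+ 2 by exact: sqr_ge0.
lra.
Unshelve. all: by end_near. Qed.

(** Opial's lemma for the set of minimizers: distances to them converge, and weak limits along
    ultrafilters minimize because [f (y t)] tends to the minimum. *)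
Lemma flow_weak_cvg : (exists z, is_argmin f z) ->
  exists2 z, is_argmin f z & forall h, ip (y t) h @[t --> +oo] --> ip z h.
Proof.
move=> [z0 zmin0].
have cvg2 z : is_argmin f z -> exists l : R, `|y t - z| ^+ 2 @[t --> +oo] --> l.
  move=> /flow_dist_cvg[l lP]; exists (l * 2).
  rewrite (_ : (fun t => _) = (fun t => `|y t - z| ^+ 2 / 2 * 2)).
    by apply: cvgM => //; exact: cvg_cst.
  by apply/funext => t; rewrite divfK.
have fy : f (y t) @[t --> +oo] --> (f z0 : R).
  have lim0 := flow_value_o zmin0.
  apply/cvgrPdist_le => e e0.
  have /cvgr_le/(_ e e0) h1 := lim0.
  have /cvgry_ge/(_ 1) h2 := tauy.
  apply: filterS2 h1 h2 => t h1 h2.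
  have h3 := zmin0 (y t); rewrite distrC ger0_norm ?subr_ge0//.
  apply: le_trans h1; rewrite -[leLHS]mul1r ler_wpM2r ?subr_ge0//.
have [l0 lP0] := cvg2 _ zmin0.
(* With [r = |y t - z0|], eventually [2 r <= r^2 + 1 <= l0 + 2]. *)
have bd : \forall t \near +oo, `|y t| <= `|z0| + (l0 + 2).
  have /cvgr_le/(_ (l0 + 1)) := lP0; rewrite ltrDl ltr01 => /(_ isT).
  apply: filterS => t h.
  rewrite -[y t](subrK z0) (le_trans (ler_normD _ _))// addrC lerD2l.
  have : 0 <= (`|y t - z0| - 1) ^+ 2 by exact: sqr_ge0.
  have := normr_ge0 (y t - z0).
  rewrite sqrrB1; nra.
apply: (opial hip _ bd cvg2) => U z UU FU zP v.
have UP := @ultra_proper _ _ UU.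
apply: le_trans (zmin0 v).
(* Weak lower semicontinuity: this expression is at least [f z] by the gradient inequality at [z],
   and its pairing vanishes along [U]. *)
have cR : f (y t) - ip (g z) (y t - z) @[t --> U] --> (f z0 - 0 : R).
  apply: cvgB; first by move=> B nB; exact: FU (fy B nB).
  rewrite (_ : (fun t => _) = (fun t => ip (y t) (g z) - ip z (g z))).
    rewrite -(subrr (ip z (g z))); apply: cvgB; [exact: zP|exact: cvg_cst].
  by apply/funext => t; rewrite (ipC hip) (ipBl hip).
rewrite -[leRHS]subr0; apply: (cvgr_to_ge cR); near=> t.
have := convex_gradient_le cvx gr z (y t); lra.
Unshelve. all: by end_near. Qed.

End GradientFlow.

(** * The inertial system *)

Section InertialSystem.
Context {R : realType} {H : completeNormedModType R} {ip : H -> H -> R}.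
Context {f : H -> R} {g : H -> H} {t0 gamma : R}.
Context {tau dtau ddtau : R -> R} {x dx ddx : R -> H}.
Context (hip : is_inner_product ip) (cvx : convex_fun f)
  (gr : is_gradient ip f g) (gamma1 : 1 < gamma)
  (tau0 : forall t, t0 < t -> 0 < tau t)
  (dtau0 : forall t, t0 < t -> 0 < dtau t)
  (Dtau : forall t, t0 < t -> is_derive t 1 tau (dtau t))
  (Ddtau : forall t, t0 < t -> is_derive t 1 dtau (ddtau t))
  (tauy : tau @ +oo --> +oo)
  (Dx : forall t, t0 < t -> is_derive t 1 x (dx t))
  (Ddx : forall t, t0 < t -> is_derive t 1 dx (ddx t)).

Let y t := x t + (gamma^-1 * (tau t / dtau t)) *: dx t.

Context (ode : forall t, t0 < t -> ddx t
  + (((1 + gamma) * dtau t ^+ 2 - tau t * ddtau t) / (tau t * dtau t)) *: dx t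
  + (gamma * dtau t ^+ 2 / tau t) *: g (y t) = 0).

(** With [q = tau / (gamma dtau)], the equation's damping coefficient is exactly [(1 + q') / q], so
    [dx] cancels in [y']; the gradient keeps the factor [q gamma dtau^2 / tau = dtau]. *)
Lemma inertial_is_flow t : t0 < t -> is_derive t 1 y (- (dtau t *: g (y t))).
Proof.
move=> t0t; have tau_gt0 := tau0 t0t; have dtau_gt0 := dtau0 t0t.
have gamma_neq0 : gamma != 0 by rewrite gt_eqF// (lt_trans ltr01).
have dtau_neq0 : dtau t != 0 by rewrite gt_eqF.
have tau_neq0 : tau t != 0 by rewrite gt_eqF.
have Dq : is_derive t 1 (fun s => gamma^-1 * (tau s / dtau s))
    (gamma^-1 * (tau t * (- dtau t ^- 2 * ddtau t) + (dtau t)^-1 * dtau t)).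
  exact (is_deriveZ gamma^-1
    (is_deriveM (Dtau t0t) (is_deriveV dtau_neq0 (Ddtau t0t)))).
have D := is_deriveD (Dx t0t) (is_derive1_scale Dq (Ddx t0t)).
refine (is_derive_eq D _).
have ddxE : ddx t = - ((((1 + gamma) * dtau t ^+ 2 - tau t * ddtau t)
      / (tau t * dtau t)) *: dx t)
    - (gamma * dtau t ^+ 2 / tau t) *: g (y t).
  by apply/eqP; rewrite -subr_eq0 opprB opprK addrA addrAC ode.
rewrite ddxE scalerBr scalerN !scalerA -[X in X + _]scale1r addrAC addrA addrA.
rewrite -scalerBl -scalerDl [X in X *: _ - _](_ : _ = 0); last first.
  by field; rewrite ?dtau_neq0 ?tau_neq0 ?gamma_neq0.
rewrite scale0r sub0r; congr (- (_ *: _)).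
by field; rewrite ?dtau_neq0 ?tau_neq0 ?gamma_neq0.
Qed.

Lemma inertial_velocity t : t0 < t ->
  dx t = (gamma * (dtau t / tau t)) *: (y t - x t).
Proof.
move=> t0t; rewrite /y addrC addKr scalerA.
rewrite [X in X *: _](_ : _ = 1) ?scale1r//.
by field; rewrite !gt_eqF ?tau0 ?dtau0// (lt_trans ltr01).
Qed.

(** Convexity gives [ip (g x) (y - x) <= f y - f x], a decay rate [gamma]; differentiating the
    weight [tau] costs 1, which leaves [gamma - 1]. *)
Lemma inertial_value_o z : is_argmin f z ->
  tau t * (f (x t) - f z) @[t --> +oo] --> (0 : R).
Proof.
move=> zmin.
have phi0 := flow_value_o hip cvx gr tau0 dtau0 Dtau tauy inertial_is_flow zmin.
have b0 : gamma * (tau t * (f (y t) - f z)) @[t --> +oo] --> (0 : R).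
  by rewrite -(mulr0 gamma); apply: cvgM => //; exact: cvg_cst.
have gamma0 : 0 < gamma - 1 by rewrite subr_gt0.
have Dv t : t0 < t -> is_derive t 1 (fun s => tau s * (f (x s) - f z))
    (tau t * ip (g (x t)) (dx t) + (f (x t) - f z) * dtau t).
  move=> t0t; have Df : is_derive t 1 (fun s => f (x s) - f z) (ip (g (x t)) (dx t)).
    refine (is_derive_eq
      (is_deriveB (is_derive1_gradient gr (Dx t0t))
         (is_derive_cst (f z) t 1)) _).
    by rewrite subr0.
  exact (is_deriveM (Dtau t0t) Df).
have up := limsup_le0_of_relaxation gamma0 tau0 dtau0 Dtau tauy Dv _ b0.
apply/cvgr0Pnorm_le => e e0; near=> t.
have t0t : t0 < t by near: t; apply: nbhs_pinfty_gt; exact: num_real.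
rewrite ger0_norm; last by rewrite mulr_ge0 ?subr_ge0// ltW// tau0.
near: t; apply: up => // t t0t.
have t1 := tau0 t0t; have t2 := dtau0 t0t.
rewrite {1}inertial_velocity// (ipZr hip).
have := convex_gradient_le cvx gr (x t) (y t).
set i := ip _ _ => hi.
have -> : tau t * (gamma * (dtau t / tau t) * i) = dtau t * (gamma * i).
  by field; rewrite gt_eqF.
rewrite (_ : dtau t / tau t * _ = dtau t * (gamma * (f (y t) - f z) -
    (gamma - 1) * (f (x t) - f z))); last by field; rewrite gt_eqF.
rewrite [_ * dtau t]mulrC -mulrDr ler_pM2l//.
have : gamma * i <= gamma * (f (y t) - f (x t)).
  by rewrite ler_pM2l ?(lt_trans ltr01)//; lra.
lra.
Unshelve. all: by end_near. Qed.

(* [x] is a weighted average of [y], so it inherits the weak limit of [y]. *)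
Lemma inertial_weak_cvg z h : ip (y t) h @[t --> +oo] --> ip z h ->
  ip (x t) h @[t --> +oo] --> ip z h.
Proof.
move=> yz.
have gamma0 : 0 < gamma by rewrite (lt_trans ltr01).
(* The relaxation lemma bounds only from above; using it for both [h] and [- h] gives the two
   sides. *)
have upper u : ip (y t) u @[t --> +oo] --> ip z u ->
    forall e, 0 < e -> \forall t \near +oo, ip (x t) u - ip z u <= e.
  move=> yu; pose b t := gamma * (ip (y t) u - ip z u).
  have b0 : b @ +oo --> (0 : R).
    rewrite -(mulr0 gamma) -(subrr (ip z u)).
    by apply: cvgM; [exact: cvg_cst|apply: cvgB => //; exact: cvg_cst].
  have Dv t : t0 < t -> is_derive t 1 (fun s => ip (x s) u - ip z u) (ip (dx t) u).
    move=> t0t; refine (is_derive_eq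
      (is_deriveB (is_derive1_ipl hip u (Dx t0t))
         (is_derive_cst (ip z u) t 1)) _).
    by rewrite subr0.
  apply: (limsup_le0_of_relaxation gamma0 tau0 dtau0 Dtau tauy Dv _ b0) => t t0t.
  rewrite inertial_velocity// (ipZl hip) (ipBl hip) /b le_eqVlt; apply/orP; left.
  by apply/eqP; ring.
have yN : ip (y t) (- h) @[t --> +oo] --> ip z (- h).
  rewrite (ipNr hip) (_ : (fun t => _) = (fun t => - ip (y t) h)); first exact: cvgN.
  by apply/funext => t; rewrite (ipNr hip).
apply/cvgrPdist_le => e e0.
apply: filterS2 (upper _ yz e e0) (upper _ yN e e0) => t.
by rewrite !(ipNr hip) ler_norml => ? ?; apply/andP; split; lra.
Qed.

End InertialSystem.

(** * Assembly of the two conclusions *)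

Lemma inf_range_argmin (R : realType) (T : Type) (f : T -> R) z :
  (forall y, f z <= f y) -> inf (range f) = f z.
Proof.
move=> zmin; apply/eqP; rewrite eq_le; apply/andP; split.
  by apply: ge_inf; [exists (f z) => _ [y _ <-]|exists z].
by apply: lb_le_inf; [exists (f z), z|move=> _ [y _ <-]].
Qed.

Unset Implicit Arguments.
Theorem mainTheorem7 (R : realType) (H : completeNormedModType R)
  (ip : H -> H -> R) (f : H -> R^o) (g : H -> H)
  (t0 gamma : R) (tau dtau ddtau : R -> R) (x dx ddx : R -> H) :
  is_inner_product ip ->
  (* assumption (A) *)
  convex_fun f -> is_gradient ip f g -> continuous g ->
  (exists z, is_argmin f z) -> lipschitz_on_bounded g ->
  (* data *)
  0 < t0 -> 1 < gamma ->
  (forall t, t0 <= t -> 0 < tau t) ->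
  deriv_on_Ici t0 tau dtau -> deriv_on_Ici t0 dtau ddtau ->
  {within `[t0, +oo[, continuous ddtau} ->
  (forall t, t0 <= t -> 0 < dtau t) ->
  tau @ +oo --> +oo ->
  deriv_on_Ici t0 x dx -> deriv_on_Ici t0 dx ddx ->
  {within `[t0, +oo[, continuous ddx} ->
  (forall t, t0 <= t ->
     ddx t
     + (((1 + gamma) * dtau t ^+ 2 - tau t * ddtau t) / (tau t * dtau t)) *: dx t
     + (gamma * dtau t ^+ 2 / tau t) *:
         g (x t + (gamma^-1 * (tau t / dtau t)) *: dx t) = 0) ->
  (fun t => (f (x t) - inf (range f)) / (tau t)^-1) @ +oo --> (0 : R)
  /\ exists2 z, is_argmin f z &
       forall y : H, (fun t => ip (x t) y) @ +oo --> ip z y.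
Proof.
move=> hip cvx gr _ argmin _ _ gamma1 tau0 dtauP ddtauP _ dtau0 tauy dxP ddxP _.
move=> ode.
have tau0' t : t0 < t -> 0 < tau t by move/ltW; exact: tau0.
have dtau0' t : t0 < t -> 0 < dtau t by move/ltW; exact: dtau0.
have Dtau := deriv_on_Ici_is_derive dtauP.
have Ddtau := deriv_on_Ici_is_derive ddtauP.
have Dx := deriv_on_Ici_is_derive dxP.
have Ddx := deriv_on_Ici_is_derive ddxP.
have ode' t (t0t : t0 < t) := ode t (ltW t0t).
split.
  have [z zmin] := argmin; rewrite (inf_range_argmin zmin).
  (* Inversion is an involution even at 0, so the little-o quotient equals this product for every
     [t], also below [t0]. *)
  rewrite (_ : (fun t => _) = (fun t => tau t * (f (x t) - f z))).
    exact: (inertial_value_o hip cvx gr gamma1 tau0' dtau0' Dtau Ddtau tauy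
      Dx Ddx ode').
  by apply/funext => t; rewrite invrK mulrC.
have yflow := inertial_is_flow gamma1 tau0' dtau0' Dtau Ddtau Dx Ddx ode'.
have [z zmin zP] := flow_weak_cvg hip cvx gr tau0' dtau0' Dtau tauy yflow argmin.
exists z => // h.
exact: (inertial_weak_cvg hip gamma1 tau0' dtau0' Dtau tauy Dx (zP h)).
Qed.
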